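(* Let $q,n,m,N$ be natural numbers with $q<n$, $m<n$ and $1<N<2^m$. Then the polynomial recognizer $\Pi=(\{0,1\}^n,N,\mathrm{init},\mathrm{test})$ with parameters $q,n,m,N$ (defined in the context) is a $(q,\infty,\varepsilon)$-secure recognizer with $$\varepsilon = 1-\left(1-\frac{N}{2^m}\right)^q .$$
   Context: **Notation.** $\mathrm{GF}(2^n)$ is the finite field with $2^n$ elements. Its elements are identified with bit strings in $\{0,1\}^n$ in the usual way (coordinates with respect to a fixed basis over $\mathrm{GF}(2)$, so field addition is bitwise XOR); likewise $\mathrm{GF}(2^m)$ and $\{0,1\}^m$ are identified. $\mathrm{trunc}_m(y)$ denotes the $m$ least significant bits of $y\in\{0,1\}^n$. For $a=(a_0,\dots,a_{k-1})\in \mathrm{GF}(2^n)^k$ define $h_a:\{0,1\}^n\to\{0,1\}^m$ by $h_a(x)=\mathrm{trunc}_m(a_0+a_1x+\dots+a_{k-1}x^{k-1})$, with arithmetic in $\mathrm{GF}(2^n)$. ''Chosen uniformly at random'' is always independent of everything else. **Recognizer.** Let $\mathcal U$ be a set (universe) and $N<|\mathcal U|$ a positive integer, and let $\mathcal K$ (keys), $\mathcal{DB}$ (databases), $\mathcal Y$ (fingerprints) be sets. $\Pi=(\mathcal U,N,\mathrm{init},\mathrm{test})$ is a recognizer for $N$ items if $\mathrm{init}$ is a probabilistic algorithm that takes a set $M=\{x_1,\dots,x_N\}\subset\mathcal U$ of $N$ distinct elements and returns $\langle db,k,y\rangle$ with $db\in\mathcal{DB}$, $k\in\mathcal K$, $y\in\mathcal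 Y$; $\mathrm{test}$ is a deterministic algorithm that takes $db\in\mathcal{DB}$, $k\in\mathcal K$, $x\in\mathcal U$ and returns an element of $\mathcal Y$; and the following correctness condition holds: whenever $\langle db,k,y\rangle\leftarrow\mathrm{init}(M)$, then $\mathrm{test}(db,k,x)=y$ for all $x\in M$. The sets $\mathcal K,\mathcal{DB},\mathcal Y$ are required to contain no elements that are never output by $\mathrm{init}$ (for any $M$); when not specified they are understood to be defined implicitly. **Collision game $\mathrm{Coll}^{\Pi}_A(q)$.** An adversary is a probabilistic algorithm $A$. (1) $A$ outputs a set $M\subset\mathcal U$ of $N$ distinct items. (2) $\langle db,k,y\rangle\leftarrow\mathrm{init}(M)$ is computed. (3) $A$ receives black-box (adaptive) access to the oracle $O^{\mathrm{test}}$ with $O^{\mathrm{test}}(x)=1$ if $\mathrm{test}(db,k,x)=y$ and $O^{\mathrm{test}}(x)=0$ otherwise; let $Q$ be the set of queries $A$ makes. (4) $A$ outputs an item $x$. The result is $1$ if $|Q|\le q$, $x\in Q$, $x\notin M$ and $\mathrm{test}(db,k,x)=y$; otherwise it is $0$. $\Pi$ is $(q,t,\varepsilon)$-secure against collisions if for every adversary $A$ running in time at most $t$ we have $\Pr[\mathrm{Coll}^{\Pi}_A(q)=1]\le\varepsilon$, the probability being over the random choices of $A$ and $\Pi$. Here $t=\infty$ means no restriction on running time. **Disclosure game $\mathrm{Disc}^{\Pi}_A(N)$.** (1) $A$ outputs $M_0,M_1\subset\mathcal U$ with $|M_0|=|M_1|=N$. (2) A uniformly random bit $b\in\{0,1\}$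 is chosen. (3) $\langle db,k,y\rangle\leftarrow\mathrm{init}(M_b)$ is computed. (4) $db$ (and nothing else) is given to $A$. (5) $A$ outputs a bit $b'$. The result is $1$ if $b=b'$ and $0$ otherwise. $\Pi$ is secure against disclosure if for all (computationally unbounded) adversaries $A$ we have $\Pr[\mathrm{Disc}^{\Pi}_A(N)=1]=0.5$. $\Pi$ is $(q,t,\varepsilon)$-secure if it is $(q,t,\varepsilon)$-secure against collisions and secure against disclosure. **The polynomial recognizer with parameters $q,n,m,N$.** The universe is $\mathcal U=\{0,1\}^n$. - $\mathrm{init}$: on input $M=\{x_1,\dots,x_N\}$ with $|M|=N$, choose $db\in\mathrm{GF}(2^n)^{q+N}$ uniformly at random, compute $\hat x_i:=h_{db}(x_i)\in\mathrm{GF}(2^m)$ for $1\le i\le N$, and set $p(\xi):=\prod_{i=1}^N(\xi-\hat x_i)+\prod_{i=1}^N\hat x_i$, a polynomial over $\mathrm{GF}(2^m)$. It has the form $p(\xi)=\xi^N+a_{N-1}\xi^{N-1}+\dots+a_1\xi$. Set $k=(a_{N-1},\dots,a_1)$ and return $\langle db,k,\mathrm{test}(db,k,x_1)\rangle$. - $\mathrm{test}$: on input $db$, $k=(a_{N-1},\dots,a_1)$ and $x$, set $p(\xi):=\xi^N+\sum_{i=1}^{N-1}a_i\xi^i$ over $\mathrm{GF}(2^m)$, compute $\hat x=h_{db}(x)$ and return $p(\hat x)$. *)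

(* Defs.v *)
From HB Require Import structures.
From mathcomp Require Import all_boot all_order all_fingroup all_algebra all_solvable all_field.
From mathcomp Require Import finmap.
From mathcomp Require Import all_classical all_reals all_analysis.

Set Implicit Arguments.
Unset Strict Implicit.
Unset Printing Implicit Defensive.

Import Order.TTheory GRing.Theory Num.Theory.
Local Open Scope classical_set_scope.
Local Open Scope ring_scope.

(** * Probabilistic algorithms

    A probabilistic algorithm is a deterministic function of its input and of
    its coins, an element drawn from an arbitrary probability space.  Coins of
    different parties are drawn independently: games are events of product
    measures. *)

Record coin_space (R : realType) := CoinSpace {
  coin_display : measure_display;
  coin :> measurableType coin_display;
  coin_law : probability coin R }.

(* A choiceType with all its subsets measurable; [t0] only serves to provide
   the base point that measurableType asks for. *)
Definition discrete (T : choiceType) (t0 : T) : Type := T.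

Section Discrete.
Variables (T : choiceType) (t0 : T).
HB.instance Definition _ := Choice.on (discrete t0).
HB.instance Definition _ := isPointed.Build (discrete t0) t0.
HB.instance Definition _ := @isMeasurable.Build default_measure_display
  (discrete t0) discrete_measurable discrete_measurable0
  discrete_measurableC discrete_measurableU.
End Discrete.

(* The uniform law is the normalized counting measure; the last argument of
   mnormalize is a default that is used only when the total mass is 0 or +oo,
   which never happens on a nonempty finite type. *)
Definition uniform_coins (R : realType) (T : finType) (t0 : T) : coin_space R :=
  @CoinSpace R _ (discrete t0)
    (mnormalize (@counting (discrete t0) R) (@dirac _ (discrete t0) t0 R)).

Lemma uniform_coinsE (R : realType) (T : finType) (t0 : T) (A : {set T}) :
  coin_law (uniform_coins R t0) [set` A] = ((#|A|%:R / #|T|%:R)%:E : \bar R).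
Proof.
have cnt (B : {set T}) : @counting T R [set` B] = (#|B|%:R)%:E.
  rewrite /counting asboolT; last exact: finite_finset.
  have -> : [set` B] = [set` [fset x in enum B]%fset].
    by apply/seteqP; split => x /=; rewrite !inE mem_enum.
  by rewrite set_fsetK card_fseq undup_id ?enum_uniq // -cardE.
have T_gt0 : (0 < #|T|)%N by apply/card_gt0P; exists t0.
rewrite /uniform_coins /=.
have cntT : @counting (discrete t0) R setT = (#|T|%:R)%:E.
  rewrite -cardsT -cnt; congr counting.
  by apply/seteqP; split => x //=; rewrite inE.
have cntT_neq0 : ((#|T|%:R : R)%:E == 0)%E = false.
  by rewrite eqe pnatr_eq0 gtn_eqF.
rewrite /mnormalize; case: ifPn => [|_].
  by rewrite [X in X == 0]cntT [X in X == +oo%E]cntT cntT_neq0.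
rewrite [X in (_ * (fine X)^-1%:E)%E]cntT EFinM.
by congr (_ * _)%E; exact: cnt.
Qed.

(** * Recognizers *)

Definition nset (U : finType) (N : nat) : Type := {M : {set U} | #|M| == N}.

(* Outputs of algorithms are finite strings, hence the countable types.  The
   sets of databases, keys and fingerprints proper are the subsets [dbs],
   [keys] and [fingerprints] below. *)
Record scheme (R : realType) (U : finType) (N : nat) := Scheme {
  db_t : countType;
  key_t : countType;
  fp_t : countType;
  init_coins : coin_space R;
  init : nset U N -> init_coins -> db_t * key_t * fp_t;
  init_measurable : forall M (B : set (db_t * key_t * fp_t)),
    measurable (init M @^-1` B);
  test : db_t -> key_t -> U -> fp_t }.

Section Recognizer.
Variables (R : realType) (U : finType) (N : nat) (Pi : scheme R U N).

Definition init_output : set (db_t Pi * key_t Pi * fp_t Pi) :=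
  [set o | exists M w, init (s := Pi) M w = o].

Definition dbs : set (db_t Pi) := [set o.1.1 | o in init_output].
Definition keys : set (key_t Pi) := [set o.1.2 | o in init_output].
Definition fingerprints : set (fp_t Pi) := [set o.2 | o in init_output].

Definition test_closed : Prop := forall db k x,
  dbs db -> keys k -> fingerprints (test db k x).

Definition correct : Prop := forall M w db k y,
  init (s := Pi) M w = (db, k, y) ->
  forall x, x \in val M -> test db k x = y.

Definition is_recognizer : Prop :=
  [/\ (0 < N)%N, (N < #|U|)%N, test_closed & correct].

End Recognizer.

(** * Security against collisions *)

(* What an adversary does once its coins are fixed: a terminating adaptive
   interaction with a {0,1}-valued oracle. *)
Inductive strategy (U : Type) : Type :=
| Output of U
| Query of U & (bool -> strategy U).

(* The set of queries made, and the final output. *)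
Fixpoint run (U : finType) (O : U -> bool) (s : strategy U) : {set U} * U :=
  match s with
  | Output x => (finset.set0, x)
  | Query u next => let r := run O (next (O u)) in (u |: r.1, r.2)
  end.

(* As U is finite, nset U N * strategy U is countable, so that
   [ca_measurable] only says that [ca_act] is a discrete random variable. *)
Record coll_adversary (R : realType) (U : finType) (N : nat) := CollAdversary {
  ca_coins : coin_space R;
  ca_act : ca_coins -> nset U N * strategy U;
  ca_measurable : forall B : set (nset U N * strategy U),
    measurable (ca_act @^-1` B) }.

Section Collision.
Variables (R : realType) (U : finType) (N : nat) (Pi : scheme R U N).

Definition coll_result (q : nat) (M : nset U N) (s : strategy U)
    (o : db_t Pi * key_t Pi * fp_t Pi) : bool :=
  let: (db, k, y) := o in
  let O x := test db k x == y in
  let: (Q, x) := run O s in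
  [&& (#|Q| <= q)%N, x \in Q, x \notin val M & O x].

Definition coll_prob (q : nat) (A : coll_adversary R U N) : \bar R :=
  (coin_law (ca_coins A) \x coin_law (init_coins Pi))%E
    [set w | let: (M, s) := ca_act w.1 in coll_result q M s (init M w.2)].

(* This is (q, oo, eps)-security: no bound on the running time. *)
Definition coll_secure (q : nat) (eps : R) : Prop :=
  forall A : coll_adversary R U N, (coll_prob q A <= eps%:E)%E.

End Collision.

(** * Security against disclosure *)

Record disc_adversary (R : realType) (U : finType) (N : nat) (D : Type) :=
  DiscAdversary {
    da_coins : coin_space R;
    da_choose : da_coins -> nset U N * nset U N;
    da_guess : da_coins -> D -> bool;
    da_measurable : forall MM db b,
      measurable [set w | da_choose w = MM /\ da_guess w db = b] }.

Section Disclosure.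
Variables (R : realType) (U : finType) (N : nat) (Pi : scheme R U N).

(* The coins are those of the adversary, the challenge bit, those of init. *)
Definition disc_prob (A : disc_adversary R U N (db_t Pi)) : \bar R :=
  ((coin_law (da_coins A) \x bernoulli_prob (2^-1 : R))
     \x coin_law (init_coins Pi))%E
    [set w | let: (wA, b, wI) := w in
       let: (M0, M1) := da_choose wA in
       let: (db, _, _) := init (s := Pi) (if b then M1 else M0) wI in
       da_guess wA db = b].

Definition disc_secure : Prop :=
  forall A : disc_adversary R U N (db_t Pi), disc_prob A = (2^-1 : R)%:E.

End Disclosure.

Definition secure (R : realType) (U : finType) (N : nat) (Pi : scheme R U N)
    (q : nat) (eps : R) : Prop :=
  coll_secure Pi q eps /\ disc_secure Pi.

(** * GF(2^n), bit strings and hash functions *)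

Definition gf2_space (n : nat) (F : finFieldType) (cardF : #|F| = (2 ^ n)%N) :=
  pPrimeCharType (card_finPcharP cardF isT).

(* GF(2^n) with a fixed basis over GF(2). *)
Record gf2n (n : nat) := GF2n {
  gf_field :> finFieldType;
  gf_card : #|gf_field| = (2 ^ n)%N;
  gf_basis : n.-tuple (gf2_space gf_card);
  gf_basisP : basis_of fullv gf_basis }.

Notation bits n := 'rV['F_2]_n.

Definition to_bits (n : nat) (F : gf2n n) (x : F) : bits n :=
  \row_(i < n) coord (gf_basis F) i x.

Definition of_bits (n : nat) (F : gf2n n) (s : bits n) : F :=
  \sum_(i < n) s 0 i *: (gf_basis F)`_i.

(* Bit 0 is the least significant one. *)
Definition trunc (m n : nat) (mn : (m <= n)%N) (y : bits n) : bits m :=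
  \row_(i < m) y 0 (widen_ord mn i).

Definition poly_hash (m n : nat) (mn : (m <= n)%N) (F : gf2n n) (k : nat)
    (a : {ffun 'I_k -> F}) (x : bits n) : bits m :=
  trunc mn (to_bits (\sum_(j < k) a j * of_bits F x ^+ j)).

(** * The polynomial recognizer *)

Section PolyRecognizer.
Variables (R : realType) (q n m N : nat) (mn : (m <= n)%N).
Variables (Fn : gf2n n) (Fm : gf2n m).

Definition poly_db : finType := {ffun 'I_(q + N) -> Fn}.

(* The coefficient a_(i+1) is stored at index i. *)
Definition poly_key : finType := {ffun 'I_N.-1 -> Fm}.

Definition hash_elt (db : poly_db) (x : bits n) : Fm :=
  of_bits Fm (poly_hash mn db x).

Definition init_poly (db : poly_db) (M : {set bits n}) : {poly Fm} :=
  \prod_(x in M) ('X - (hash_elt db x)%:P) + (\prod_(x in M) hash_elt db x)%:P.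

Definition poly_test (db : poly_db) (k : poly_key) (x : bits n) : Fm :=
  let p : {poly Fm} := 'X^N + \sum_(i < N.-1) k i *: 'X^(i.+1) in
  p.[hash_elt db x].

Definition poly_init_coins : coin_space R :=
  @uniform_coins R poly_db [ffun=> 0].

(* The choice of x_1 in M is immaterial; the default 0 is not used for N > 0. *)
Definition poly_init (M : nset (bits n) N) (db : poly_init_coins) :
    poly_db * poly_key * Fm :=
  let k : poly_key := [ffun i : 'I_N.-1 => (init_poly db (val M))`_i.+1] in
  (db, k, poly_test db k (head 0 (enum (val M)))).

Lemma poly_init_measurable M (B : set (poly_db * poly_key * Fm)) :
  measurable (poly_init M @^-1` B).
Proof. by []. Qed.

Definition poly_recognizer : scheme R (bits n) N :=
  @Scheme R (bits n) N poly_db poly_key Fm poly_init_coins poly_init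
    poly_init_measurable poly_test.

End PolyRecognizer.

(* Main.v *)
(** Over [GF(2^m)], [p(xi) - y] is the product of the [xi - h(w)] for [w] in [M],
    so a query [x] is answered positively exactly when [h(x)] lies in [h(M)].
    Before its first success outside [M] the adversary only sees answers it can
    predict, so it wins only if one of at most [q] elements [x] outside [M], which
    depend on [M] and its coins but not on the database, has [h(x)] in [h(M)].
    If at most [q + N - 1] values of the random polynomial matter so far, adding
    a multiple of a polynomial that vanishes at all of them makes the next hash
    uniform; each new element therefore misses [h(M)] with conditional probability
    at least [1 - N / 2^m].  Disclosure is immediate, since the database is drawn
    independently of the set. *)

Require Import Defs.
From mathcomp Require Import all_boot all_order all_algebra all_field.
From mathcomp Require Import all_classical all_reals all_analysis.
From mathcomp Require Import zify lra.
Import Order.TTheory GRing.Theory Num.Theory.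
Local Open Scope ring_scope.

Set Implicit Arguments.
Unset Strict Implicit.
Unset Printing Implicit Defensive.

(** * Field elements and their bit strings *)

Lemma to_bitsK n (F : gf2n n) (x : F) : of_bits F (to_bits x) = x.
Proof.
rewrite [RHS](coord_basis (gf_basisP F) (memvf (x : gf2_space (gf_card F)))).
by apply: eq_bigr => i _; rewrite mxE.
Qed.

Lemma of_bitsK n (F : gf2n n) (s : bits n) : to_bits (of_bits F s) = s.
Proof.
apply/rowP => i; rewrite mxE /of_bits.
by rewrite coord_sum_free // (basis_free (gf_basisP F)).
Qed.

Lemma to_bitsD n (F : gf2n n) : {morph @to_bits n F : x y / x + y}.
Proof. by move=> x y; apply/rowP => i; rewrite !mxE; exact: raddfD. Qed.

Lemma of_bitsD n (F : gf2n n) : {morph of_bits F : s t / s + t}.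
Proof.
move=> s t; rewrite /of_bits -big_split /=.
by apply: eq_bigr => i _; rewrite mxE scalerDl.
Qed.

Lemma of_bits_inj n (F : gf2n n) : injective (of_bits F).
Proof. exact: can_inj (@of_bitsK n F). Qed.

(** The key omits the leading coefficient 1 and the constant coefficient 0; this is what lets
    [poly_test] recover the whole polynomial from it. *)
Lemma monic_sum_coef (F : nzRingType) (p : {poly F}) k :
    p \is monic -> size p = k.+2 -> p`_0 = 0 ->
  p = 'X^(k.+1) + \sum_(i < k) p`_i.+1 *: 'X^(i.+1).
Proof.
move=> /monicP mp sp p0; have pk : p`_k.+1 = 1 by rewrite -mp lead_coefE sp.
rewrite -[LHS]coefK poly_def sp big_ord_recr /= addrC.
by rewrite pk scale1r big_ord_recl p0 scale0r add0r.
Qed.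

(** * Distribution of the hash values of a random database *)

Section Hash.
Variables (q n m N : nat) (mn : (m <= n)%N) (Fn : gf2n n) (Fm : gf2n m).
Notation DB := {ffun 'I_(q + N) -> Fn}.
Notation hash := (@hash_elt q n m N mn Fn Fm).

Definition field_trunc (y : Fn) : Fm := of_bits Fm (trunc mn (to_bits y)).

Definition poly_eval (a : DB) (z : Fn) : Fn := \sum_(j < q + N) a j * z ^+ j.

Lemma hashE (db : DB) x : hash db x = field_trunc (poly_eval db (of_bits Fn x)).
Proof. by []. Qed.

Lemma field_truncD : {morph field_trunc : y z / y + z}.
Proof.
move=> y z; rewrite /field_trunc to_bitsD -of_bitsD.
by congr of_bits; apply/rowP => i; rewrite !mxE.
Qed.

Lemma field_trunc_surj (v : Fm) : exists y, field_trunc y = v.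
Proof.
(* The preimage pads the bits of [v] with zeros in the positions from [m] on. *)
pose s : bits n := \row_(i < n)
  if (insub (val i) : option 'I_m) is Some j then to_bits v 0 j else 0.
exists (of_bits Fn s); rewrite /field_trunc of_bitsK -[RHS]to_bitsK.
congr of_bits; apply/rowP => i; rewrite !mxE /= insubT //= => lt_im.
by rewrite !mxE; congr (coord _ _ _); apply: val_inj.
Qed.

Lemma poly_evalD (a b : DB) z : poly_eval (a + b) z = poly_eval a z + poly_eval b z.
Proof.
by rewrite /poly_eval -big_split /=; apply: eq_bigr => j _; rewrite ffunE mulrDl.
Qed.

Lemma poly_eval_poly (p : {poly Fn}) z : (size p <= q + N)%N ->
  poly_eval [ffun j : 'I_(q + N) => p`_j] z = p.[z].
Proof.
move=> sp; rewrite (horner_coef_wide _ sp).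
by apply: eq_bigr => j _; rewrite ffunE.
Qed.

(** The monic polynomial with roots at [W] has degree [#|W|], so its coefficients fit in a database.
    It does not vanish at [x], so its multiples can give the hash of [x] any increment. *)
Lemma hash_shift (W : {set bits n}) x : x \notin W -> (#|W| < q + N)%N ->
  exists delta : Fm -> DB, forall t (db : DB),
    {in W, hash (db + delta t) =1 hash db} /\ hash (db + delta t) x = hash db x + t.
Proof.
move=> xW ltW; pose z := of_bits Fn x.
pose p : {poly Fn} := \prod_(w <- enum W) ('X - (of_bits Fn w)%:P).
have pz : p.[z] != 0.
  rewrite horner_prod prodf_seq_neq0; apply/allP => w; rewrite mem_enum => wW.
  rewrite !hornerE subr_eq0; apply: contraNneq xW => /of_bits_inj ->.
  by rewrite wW.
have sp c : (size (c *: p) <= q + N)%N.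
  by rewrite (leq_trans (size_scale_leq _ _)) // size_prod_XsubC -cardE.
have pick t : exists c : Fn, field_trunc c == t.
  by have [c <-] := field_trunc_surj t; exists c.
(* Take for [delta t] the multiple of [p] whose value at [z] truncates to [t]. *)
exists (fun t => [ffun j : 'I_(q + N) => ((xchoose (pick t) / p.[z]) *: p)`_j]).
move=> t db; split=> [w wW|]; rewrite !hashE poly_evalD poly_eval_poly // hornerZ.
  suff -> : p.[of_bits Fn w] = 0 by rewrite mulr0 addr0.
  rewrite horner_prod (big_rem w) ?mem_enum //= !hornerE subrr mul0r //.
by rewrite divfK // field_truncD (eqP (xchooseP (pick t))).
Qed.

Lemma hash_const (t : Fm) : (0 < q + N)%N -> exists db : DB, forall x, hash db x = t.
Proof.
move=> qN; have [c <-] := field_trunc_surj t.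
exists [ffun j : 'I_(q + N) => c%:P`_j] => x.
by rewrite hashE poly_eval_poly ?hornerC // (leq_trans (size_polyC_leq1 _)).
Qed.

(** A conditional probability cleared of denominators: given an event [A] decided by the hashes on
    [W], the hash of [x] is still uniform, so it meets the image of [M] with probability at most
    [#|M| / #|Fm|]. *)
Lemma card_hit_le (M W : {set bits n}) x (A : {set DB}) :
    x \notin W -> M \subset W -> (#|W| < q + N)%N ->
    (forall db db' : DB, {in W, hash db =1 hash db'} -> (db \in A) = (db' \in A)) ->
  (#|[set db in A | hash db x \in hash db @: M]| * #|Fm| <= #|M| * #|A|)%N.
Proof.
move=> xW /fintype.subsetP MW ltW detA; have [delta Hd] := hash_shift xW ltW.
set B := [set db in A | _].
(* Average over the translations [db + delta t], which permute the databases. *)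
have -> : (#|B| * #|Fm| = \sum_(t : Fm) \sum_(db : DB) ((db + delta t)%R \in B))%N.
  rewrite mulnC -sum_nat_const; apply: eq_bigr => t _.
  rewrite -sum1_card big_mkcond (reindex_inj (addIr (delta t))).
  by apply: eq_bigr => db _; case: ifP.
rewrite exchange_big /= mulnC -sum_nat_const [leqRHS]big_mkcond.
apply: leq_sum => db _; case: ifPn => dbA; last first.
  rewrite big1 // => t _; rewrite inE.
  by rewrite (detA _ db) ?(negPf dbA) //; case: (Hd t db).
(* For fixed [db], adding [t] to [hash db x] is a bijection in [t], so each element of the image of
   [M] is hit for exactly one [t]. *)
rewrite (leq_trans _ (leq_imset_card (hash db) M)) //.
rewrite -sum1_card [leqRHS]big_mkcond [leqRHS](reindex_inj (addrI (hash db x))) leq_sum // => t _.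
have [eqW eqx] := Hd t db; rewrite inE eqx.
have -> : hash (db + delta t) @: M = hash db @: M.
  by apply: eq_in_imset => w wM; rewrite eqW ?MW.
by case: (_ \in A); case: (_ \in hash db @: M).
Qed.

Definition avoiding (M D : {set bits n}) : {set DB} :=
  [set db | [forall x in D, hash db x \notin hash db @: M]].

Lemma avoiding0 M : avoiding M finset.set0 = finset.setT.
Proof. by apply/setP => db; rewrite !inE; apply/forall_inP => x; rewrite inE. Qed.

(** Induction on [#|D|]. Each [x] removed from [D] costs a factor [1 - #|M| / #|Fm|], because
    avoidance on the rest is decided by the at most [q + N - 1] hashes on [M :|: D']. *)
Lemma card_avoiding_ge (M D : {set bits n}) :
    [disjoint M & D] -> (#|M| + #|D| <= q + N)%N ->
  ((#|Fm| - #|M|) ^ #|D| * #|DB| <= #|avoiding M D| * #|Fm| ^ #|D|)%N.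
Proof.
have [d] := ubnP #|D|; elim: d D => // d IH D ltd dMD leD.
have [->|[x xD]] := set_0Vmem D.
  by rewrite avoiding0 !cards0 !expn0 mul1n muln1 cardsT.
pose D' := D :\ x; have cD : #|D| = #|D'|.+1 by rewrite (cardsD1 x D) xD.
have xM : x \notin M by rewrite (disjointFl dMD xD).
have sD : D' \subset D by exact: subD1set.
have dMD' : [disjoint M & D'] by exact: disjointWr sD dMD.
have {}IH : ((#|Fm| - #|M|) ^ #|D'| * #|DB| <= #|avoiding M D'| * #|Fm| ^ #|D'|)%N.
  by apply: IH => //; lia.
have hit : (#|[set db in avoiding M D' | hash db x \in hash db @: M]| * #|Fm|
            <= #|M| * #|avoiding M D'|)%N.
  apply: (@card_hit_le M (M :|: D')); rewrite ?finset.subsetUl //.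
  - by rewrite !inE eqxx (negPf xM).
  - by rewrite (leq_ltn_trans (leq_card_setU _ _)) //; lia.
  move=> db db' eqW; rewrite !inE.
  have eqM : hash db @: M = hash db' @: M.
    by apply: eq_in_imset => w wM; rewrite eqW // inE wM.
  apply: eq_forallb_in => w wD.
  by rewrite eqM eqW // inE wD orbT.
(* Split the databases that avoid on [D'] by whether [x] hits as well. *)
have cA : (#|avoiding M D'| = #|[set db in avoiding M D' | hash db x \in hash db @: M]|
    + #|avoiding M D|)%N.
  rewrite -(cardsID [set db | hash db x \in hash db @: M] (avoiding M D')).
  congr (_ + _)%N; apply: eq_card => db; rewrite !inE //.
  apply/andP/forall_inP => [[hx /forall_inP hD] w wD|hD].
    by have [->|wx] := eqVneq w x; [|apply: hD; rewrite !inE wx].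
  by split; [exact: hD|apply/forall_inP => w wD; apply: hD; exact: (fintype.subsetP sD)].
have step : ((#|Fm| - #|M|) * #|avoiding M D'| <= #|avoiding M D| * #|Fm|)%N.
  by rewrite mulnBl leq_subLR {1}cA mulnDr mulnC; nia.
rewrite cD !expnS -mulnA (leq_trans (leq_mul (leqnn _) IH)) //.
by rewrite !mulnA leq_mul2r step orbT.
Qed.

(** * The key polynomial and the answers of the oracle *)

Lemma size_init_poly (db : DB) (M : {set bits n}) : (0 < #|M|)%N ->
  size (init_poly mn Fm db M) = #|M|.+1 /\ init_poly mn Fm db M \is monic.
Proof.
move=> M0; set p := init_poly _ _ _ _.
have Ep : p = \prod_(x <- enum M) ('X - (hash db x)%:P) + (\prod_(x in M) hash db x)%:P.
  by rewrite big_enum.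
have lt : (size (\prod_(x in M) hash db x)%:P%R <
           size (\prod_(x <- enum M) ('X - (hash db x)%:P))%R)%N.
  by rewrite size_prod_XsubC -cardE (leq_ltn_trans (size_polyC_leq1 _)).
rewrite Ep size_polyDl // size_prod_XsubC -cardE; split=> //.
by rewrite monicE lead_coefDl // -monicE monic_prod_XsubC.
Qed.

(** In characteristic 2 signs disappear, so the product at 0 equals the added constant and the two
    cancel. *)
Lemma init_poly0 (db : DB) (M : {set bits n}) : (init_poly mn Fm db M)`_0 = 0.
Proof.
have char2 : 2 \in [pchar Fm] by exact: card_finPcharP (gf_card Fm) isT.
rewrite -horner_coef0 hornerE horner_prod hornerC.
under eq_bigr do rewrite hornerXsubC sub0r (oppr_pchar2 char2).
exact: addrr_pchar2.
Qed.

Section Init.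
Variables (R : realType) (M : nset (bits n) N).
Hypothesis N_gt0 : (0 < N)%N.
Notation poly_init := (@poly_init R q n m N mn Fn Fm M).

Lemma poly_test_init (db : DB) x :
  poly_test mn db (poly_init db).1.2 x =
    \prod_(w in val M) (hash db x - hash db w) + \prod_(w in val M) hash db w.
Proof.
have cM := eqP (valP M).
have [|sp mp] := @size_init_poly db (val M); first by rewrite cM.
rewrite /poly_test /=; under eq_bigr do rewrite ffunE.
rewrite -[in 'X^N](prednK N_gt0) -monic_sum_coef ?init_poly0 //; last first.
  by rewrite sp cM prednK.
by rewrite hornerE horner_prod hornerC; under eq_bigr do rewrite hornerXsubC.
Qed.

Lemma poly_test_mem (db : DB) x : x \in val M ->
  poly_test mn db (poly_init db).1.2 x = \prod_(w in val M) hash db w.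
Proof. by move=> xM; rewrite poly_test_init (bigD1 x) //= subrr mul0r add0r. Qed.

Lemma poly_init_fp (db : DB) : (poly_init db).2 = \prod_(w in val M) hash db w.
Proof.
apply: (poly_test_mem db); rewrite -mem_enum; have := cardE (val M).
(* Since [N > 0], the head of the enumeration is a genuine element of [M] and not the default 0. *)
by case: (enum _) => [|w s _]; rewrite ?mem_head // (eqP (valP M)) => N0; have := N_gt0; rewrite N0.
Qed.

Lemma poly_oracleE (db : DB) x :
  (poly_test mn db (poly_init db).1.2 x == (poly_init db).2) =
    (hash db x \in hash db @: val M).
Proof.
rewrite poly_init_fp poly_test_init -subr_eq0 addrK.
apply/idP/imsetP => [/prodf_eq0[w wM]|[w wM ->]].
  by rewrite subr_eq0 => /eqP; exists w.
by rewrite (bigD1 w) //= subrr mul0r.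
Qed.
End Init.
End Hash.

(** * Queries under predicted answers *)

Section Path.
Variables (U : finType) (M : {set U}) (q : nat).

(* The queries of [s] when each query [u] is answered by [u \in M], added to [C]
   until [q] distinct elements have been collected. *)
Fixpoint path_queries (s : strategy U) (C : {set U}) : {set U} :=
  if s is Query u next then
    if (#|u |: C| <= q)%N then path_queries (next (u \in M)) (u |: C) else C
  else C.

Lemma path_queries_sub s (C : {set U}) : C \subset path_queries s C.
Proof.
elim: s C => //= u next IH C; case: ifP => // _.
exact: fintype.subset_trans (finset.subsetUr _ _) (IH _ _).
Qed.

Lemma card_path_queries s (C : {set U}) : (#|C| <= q)%N -> (#|path_queries s C| <= q)%N.
Proof. by elim: s C => //= u next IH C leC; case: ifP => // /IH. Qed.

(** The real run follows the predicted path until an answer first differs from membership in [M].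
    The set [C] of earlier queries makes the induction go through. *)
Lemma run_path_queries (O : U -> bool) s (C : {set U}) : {in M, forall x, O x} ->
    (#|C :|: (run O s).1| <= q)%N ->
    (exists2 x, x \in (C :|: (run O s).1) :\: M & O x) ->
  exists2 x, x \in path_queries s C :\: M & O x.
Proof.
move=> OM; elim: s C => [x|u next IH] C /=; first by rewrite finset.setU0.
rewrite finset.setUA [C :|: _]finset.setUC => leq_q hit.
rewrite (leq_trans (subset_leq_card (finset.subsetUl _ _)) leq_q).
have [OuM|] := boolP ((O u) == (u \in M)).
  by move: leq_q hit; rewrite (eqP OuM); exact: IH.
(* As [O] accepts all of [M], a wrong prediction means that [u] is outside [M] and accepted; the
   path already contains this [u]. *)
case uM: (u \in M); first by rewrite OM.
case Ou: (O u) => // _; exists u => //; rewrite inE uM /=.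
by apply: (fintype.subsetP (path_queries_sub _ _)); rewrite !inE eqxx.
Qed.
End Path.

(** * Security against collisions *)

Lemma coll_prob_le (R : realType) (U : finType) (N : nat) (Pi : scheme R U N)
    (q : nat) (A : coll_adversary R U N) (eps : R) :
    (forall M s, (coin_law (init_coins Pi)
      [set w | coll_result q M s (init M w)]%classic <= eps%:E)%E) ->
  (coll_prob Pi q A <= eps%:E)%E.
Proof.
move=> le_eps; pose P (a : nset U N * strategy U) :=
  coin_law (init_coins Pi) [set w | coll_result q a.1 a.2 (init a.1 w)]%classic.
have xsectionE x : (coin_law (init_coins Pi) (xsection
    [set w | let: (M, s) := ca_act w.1 in coll_result q M s (init M w.2)]%classic x)
    = P (ca_act (c := A) x)).
  by congr (coin_law _ _); apply/seteqP; split=> w; rewrite /xsection/= inE/=; case: (ca_act x).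
(* Integrate over the coins of the adversary: once they fix [M] and the strategy, the inner
   probability is at most [eps]. *)
rewrite /coll_prob /product_measure1 /=.
under eq_integral do rewrite xsectionE.
rewrite (@le_trans _ _ (\int[coin_law (ca_coins A)]_x (cst eps%:E x))%E) //.
  apply: ge0_le_integral => //.
  (* The integrand factors through [ca_act], all of whose preimages are measurable. *)
  - move=> _ Y _; rewrite setTI.
    rewrite (_ : _ @^-1` Y = ca_act (c := A) @^-1` (P @^-1` Y))%classic //.
    exact: ca_measurable.
  by move=> x _; exact: le_eps.
by rewrite integral_cst //= [X in (_ * X)%E]probability_setT mule1.
Qed.

Section Poly.
Variables (R : realType) (q n m N : nat) (mn : (m <= n)%N) (Fn : gf2n n) (Fm : gf2n m).
Hypotheses (N_gt0 : (0 < N)%N) (N_le : (N <= 2 ^ m)%N).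
Notation DB := {ffun 'I_(q + N) -> Fn}.
Notation Pi := (poly_recognizer R q N mn Fn Fm).

Lemma card_poly_db_gt0 : (0 < #|DB|)%N.
Proof. by apply/card_gt0P; exists [ffun=> 0]. Qed.

Lemma avoiding_prob_ge (M D : {set bits n}) :
    #|M| = N -> [disjoint M & D] -> (#|D| <= q)%N ->
  (1 - N%:R / 2 ^+ m) ^+ q <= #|avoiding q N mn Fn Fm M D|%:R / #|DB|%:R :> R.
Proof.
move=> cM dMD leD.
have := @card_avoiding_ge q n m N mn Fn Fm M D dMD.
rewrite cM addnC leq_add2r => /(_ leD).
rewrite -(ler_nat R) !natrM !natrX (gf_card Fm) natrB // natrX => le.
have K0 : 0 < 2 ^+ m :> R by exact: exprn_gt0.
have NK : N%:R / 2 ^+ m <= 1 :> R by rewrite ler_pdivrMr // mul1r -natrX ler_nat.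
(* The base lies between 0 and 1, so raising the exponent from [#|D|] to [q] only lowers the
   bound. *)
rewrite (@le_trans _ _ ((1 - N%:R / 2 ^+ m) ^+ #|D|)) //.
  by apply: ler_wiXn2l => //; rewrite ?subr_ge0 // gerBl divr_ge0 // exprn_ge0.
rewrite ler_pdivlMr ?ltr0n ?card_poly_db_gt0 //.
rewrite -(ler_pM2r (exprn_gt0 #|D| K0)) (le_trans _ le) //.
rewrite mulrAC -exprMn mulrBl mul1r divfK ?gt_eqF //.
Qed.

Lemma poly_coll_secure : coll_secure Pi q (1 - (1 - N%:R / 2 ^+ m) ^+ q).
Proof.
move=> A; apply: coll_prob_le => M s.
pose B : {set DB} := [set db | coll_result (Pi := Pi) q M s (@poly_init R q n m N mn Fn Fm M db)].
rewrite (_ : mkset _ = [set` B]%classic); last by apply/seteqP; split=> db; rewrite /= inE.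
rewrite [X in (X <= _)%E]uniform_coinsE lee_fin.
(* [D] depends on [M] and [s] but not on the database, so the counting bound applies to it. *)
pose D := path_queries (val M) q s finset.set0 :\: val M.
have cM := eqP (valP M).
have leD : (#|D| <= q)%N.
  by rewrite (leq_trans (subset_leq_card (finset.subsetDl _ _))) // card_path_queries ?cards0.
have dMD : [disjoint val M & D].
  by rewrite disjoint_sym /D finset.disjoints_subset finset.setDE finset.subsetIr.
have sB : B \subset ~: avoiding q N mn Fn Fm (val M) D.
  apply/fintype.subsetP => db; rewrite [in X in X -> _]inE /coll_result /=.
  set O := fun x => _ == _.
  case Er: (run _ s) => [Q x] /and4P[leQ xQ xM Ox].
  have OE y : O y = (hash_elt mn Fm db y \in (hash_elt mn Fm db) @: val M).
    exact: (poly_oracleE mn Fm R M N_gt0).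
  have [y yD Oy] : exists2 y, y \in D & O y.
    apply: run_path_queries.
    - by move=> y yM; rewrite OE; exact: imset_f.
    - by rewrite Er finset.set0U.
    - by exists x; rewrite // Er finset.set0U !inE xM.
  by rewrite !inE; apply/forall_inPn; exists y; rewrite // negbK -OE.
have /= := avoiding_prob_ge cM dMD leD; rewrite lerBrDl -lerBrDr => /le_trans; apply.
rewrite lerBrDr -mulrDl ler_pdivrMr ?ltr0n ?card_poly_db_gt0 // mul1r -natrD ler_nat.
by rewrite -(cardsC (avoiding q N mn Fn Fm (val M) D)) leq_add2l subset_leq_card.
Qed.

End Poly.

(** * Security against disclosure *)

Lemma fair_coin (R : realType) (b : bool) :
  bernoulli_prob (2^-1 : R) [set b]%classic = (2^-1 : R)%:E.
Proof.
have p01 : 0 <= (2^-1 : R) <= 1 by rewrite invr_ge0 ler0n invf_le1 ?ler1n ?ltr0n.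
rewrite bernoulli_probE // !diracE.
have mem1 c : (c \in [set b]%classic) = (c == b) by apply/idP/eqP; rewrite inE.
rewrite !mem1; case: b {mem1} => /=; rewrite mule0 mule1 ?adde0 ?add0e //.
by rewrite /unstable.onem; congr (_%:E); lra.
Qed.

Lemma measure_bigcup_finType d (X : measurableType d) (R : realType)
    (mu : {measure set X -> \bar R}) (T : finType) (F : T -> set X) :
    (forall i, measurable (F i)) -> trivIset [set: T] F ->
  mu (\bigcup_i F i)%classic = (\sum_i mu (F i))%E.
Proof.
move=> mF tF; rewrite measure_fin_bigcup //; last exact: finite_finset.
rewrite (_ : [set: T] = [set` enum T])%classic.
  by rewrite -fsbig_seq ?enum_uniq // big_enum.
by apply/seteqP; split=> i //= _; rewrite mem_enum.
Qed.

(** Whatever [guess x t] is, it equals exactly one of the two equally likely values of the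
    independent bit. *)
Lemma guess_prob d (X : measurableType d) (R : realType) (P : probability X R)
    (T : finType) (t0 : T) (guess : X -> T -> bool) :
    (forall t b, measurable [set x | guess x t = b]%classic) ->
  ((P \x bernoulli_prob (2^-1 : R)) \x coin_law (uniform_coins R t0))%E
    [set w | guess w.1.1 w.2 = w.1.2]%classic = (2^-1 : R)%:E.
Proof.
move=> mguess.
(* The event is a finite disjoint union of measurable rectangles, one for each pair of a database
   and a bit. *)
pose F (i : T * bool) : set (X * bool * uniform_coins R t0)%type :=
  ([set x | guess x i.1 = i.2] `*` [set i.2] `*` [set i.1])%classic.
rewrite (_ : mkset _ = \bigcup_i F i)%classic; last first.
  apply/seteqP; split=> [[[x b] t] /= gx|[[x b] t] [[t' b'] _ [[/= gx ->] ->]]] //=.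
  by exists (t, b).
have mFl i : measurable ([set x | guess x i.1 = i.2] `*` [set i.2])%classic.
  exact: measurableX.
have mF i : measurable (F i) by exact: measurableX.
have tF : trivIset [set: T * bool] F.
  move=> [t b] [t' b'] _ _ [[[x b''] t'']].
  by case=> -[[_ /= <-] /= <-] [[_ /= <-] /= <-].
rewrite measure_bigcup_finType //.
have F_prob i : (((P \x bernoulli_prob (2^-1 : R)) \x coin_law (uniform_coins R t0)) (F i) =
   P [set x | guess x i.1 = i.2]%classic * (2^-1 / #|T|%:R : R)%:E)%E.
  rewrite product_measure1E // [X in (X * _)%E]product_measure1E //.
  rewrite [X in (_ * X * _)%E]fair_coin EFinM muleA; congr (_ * _)%E.
  rewrite (_ : [set i.1]%classic = [set` [set i.1]%SET]%classic).
    by rewrite [LHS]uniform_coinsE cards1 mul1r.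
  by apply/seteqP; split=> x /=; rewrite inE => /eqP.
rewrite (eq_bigr _ (fun i _ => F_prob i)).
rewrite -(pair_bigA _ (fun t b =>
  P [set x | guess x t = b]%classic * (2^-1 / #|T|%:R : R)%:E)%E) /=.
have guess_total t :
    (P [set x | guess x t = true]%classic + P [set x | guess x t = false]%classic = 1)%E.
  rewrite -(probability_setT P) -measureU //; last by rewrite -subset0 => x [/= ->].
  by congr (P _); apply/seteqP; split=> x //= _; case: (guess x t); [left|right].
under eq_bigr do rewrite big_bool /= -ge0_muleDl ?measure_ge0 // guess_total mul1e.
rewrite sumEFin sumr_const -[X in X%:E]mulr_natr divfK // pnatr_eq0 -lt0n.
by apply/card_gt0P; exists t0.
Qed.

Lemma measurable_guess (R : realType) (U : finType) (N : nat) (D : Type)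
    (A : disc_adversary R U N D) db b :
  measurable [set w | da_guess (d := A) w db = b]%classic.
Proof.
rewrite (_ : mkset _ = \bigcup_(MM in [set: nset U N * nset U N])
   [set w | da_choose (d := A) w = MM /\ da_guess (d := A) w db = b])%classic.
  apply: fin_bigcup_measurable => [|MM _]; last exact: da_measurable.
  exact: (@finite_finset ({M : {set U} | #|M| == N} * {M : {set U} | #|M| == N})%type).
by apply/seteqP; split=> [w /= gw|w [MM _ []] //]; exists (da_choose w).
Qed.

Lemma poly_disc_secure (R : realType) (q n m N : nat) (mn : (m <= n)%N)
    (Fn : gf2n n) (Fm : gf2n m) :
  disc_secure (poly_recognizer R q N mn Fn Fm).
Proof.
move=> A; rewrite /disc_prob.
(* [init] returns its own coins as the database for either set, so the chosen sets drop out of the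
   event. *)
rewrite (_ : mkset _ = [set w | da_guess (d := A) w.1.1 w.2 = w.1.2])%classic.
  exact: (@guess_prob _ _ R (coin_law (da_coins A)) (poly_db q N Fn) [ffun=> 0]
    (da_guess (d := A)) (measurable_guess A)).
by apply/seteqP; split=> -[[wA b] db] /=; case: (da_choose wA).
Qed.

(** * The recognizer conditions *)

Section Recog.
Variables (R : realType) (q n m N : nat) (mn : (m <= n)%N) (Fn : gf2n n) (Fm : gf2n m).
Hypotheses (N_gt0 : (0 < N)%N) (N_lt : (N < 2 ^ n)%N).
Notation DB := {ffun 'I_(q + N) -> Fn}.
Notation Pi := (poly_recognizer R q N mn Fn Fm).

Lemma card_bits : #|{: bits n}| = (2 ^ n)%N.
Proof. by rewrite card_mx mul1n card_Fp. Qed.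

(** Start from a database hashing everything to 1 and shift the hash of a single [x] in [M] to [y],
    keeping the other factors 1. *)
Lemma fp_onto (M : nset (bits n) N) (y : Fm) :
  exists db : DB, \prod_(x in val M) hash_elt mn Fm db x = y.
Proof.
have cM := eqP (valP M).
have /card_gt0P[x xM] : (0 < #|val M|)%N by rewrite cM.
have [||delta Hd] := @hash_shift q n m N mn Fn Fm (val M :\ x) x.
- by rewrite !inE eqxx.
- by have := cardsD1 x (val M); rewrite xM cM; lia.
have [|db1 hdb1] := @hash_const q n m N mn Fn Fm 1; first by rewrite addn_gt0 N_gt0 orbT.
have [eqW eqx] := Hd (y - 1) db1.
exists (db1 + delta (y - 1)); rewrite (bigD1 x) //= eqx hdb1 addrC subrK.
rewrite big1 ?mulr1 // => w /andP[wM wx].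
by rewrite eqW ?hdb1 // !inE wx wM.
Qed.

Lemma poly_is_recognizer : is_recognizer Pi.
Proof.
split=> //.
- by rewrite card_bits.
- move=> db k x _ _.
  (* Any set of [N] elements will do: with it, every element of [Fm] occurs as a fingerprint. *)
  have [M sM] : exists M : {set bits n}, #|M| == N.
    exists [set:: take N (enum {: bits n})]; rewrite cardsE.
    by rewrite (card_uniqP _) ?take_uniq ?enum_uniq // size_takel // -cardE card_bits ltnW.
  pose M' : nset (bits n) N := exist _ M sM.
  have [db' <-] := fp_onto M' (test (s := Pi) db k x).
  exists (@poly_init R q n m N mn Fn Fm M' db'); first by exists M', db'.
  exact: (poly_init_fp mn Fm R M' N_gt0 db').
move=> M db' db k y /= E x xM; have := poly_test_mem mn Fm R N_gt0 db' xM.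
have := poly_init_fp mn Fm R M N_gt0 db'; rewrite E /= => <-.
by move: E; rewrite /poly_init => -[-> <- _].
Qed.
End Recog.

Theorem theorem5p9 (R : realType) (q n m N : nat)
    (lt_qn : (q < n)%N) (lt_mn : (m < n)%N)
    (gt_N1 : (1 < N)%N) (lt_N2m : (N < 2 ^ m)%N)
    (Fn : gf2n n) (Fm : gf2n m) :
  let Pi := poly_recognizer R q N (ltnW lt_mn) Fn Fm in
  is_recognizer Pi /\ secure Pi q (1 - (1 - N%:R / 2 ^+ m) ^+ q).
Proof.
have N_gt0 : (0 < N)%N by exact: ltnW.
have N_lt : (N < 2 ^ n)%N by rewrite (leq_trans lt_N2m) // leq_exp2l // ltnW.
split; first exact: poly_is_recognizer.
by split; [exact: poly_coll_secure (ltnW lt_N2m) | exact: poly_disc_secure].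
Qed.
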